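(* There is an infinite family of (pairwise non-isomorphic) cubic graphs $G$ whose list normal chromatic index satisfies $\chi_{n,l}'(G) \ge 9$.
   Context: Graphs are finite and simple; a cubic graph is a $3$-regular graph. A normal edge-coloring of a cubic graph $G$ is a proper edge-coloring such that, for every edge $e$, the set of colors appearing on the edges adjacent to $e$ has exactly four elements (then $e$ is called rich) or exactly two elements (then $e$ is called poor). A list assignment $L$ for $G$ assigns to each edge $e$ of $G$ a list (set) $L(e)$ of possible colors. The list normal chromatic index $\chi_{n,l}'(G)$ is the least $k$ such that, for every list assignment $L$ with $|L(e)|\ge k$ for every $e\in E(G)$, there is a normal edge-coloring $\varphi$ of $G$ with $\varphi(e)\in L(e)$ for every $e\in E(G)$. *)

(* Defs.v *)
From HB Require Import structures.
From mathcomp Require Import all_boot.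
From mathcomp Require Import finmap.

Set Implicit Arguments.
Unset Strict Implicit.
Unset Printing Implicit Defensive.

Record sgraph := SGraph {
  vertex :> finType;
  adj : rel vertex;
  adj_sym : symmetric adj;
  adj_irrefl : irreflexive adj }.

Definition graph_iso (G H : sgraph) : Prop :=
  exists2 f : G -> H, bijective f & forall x y, adj (f x) (f y) = adj x y.

Definition cubic (G : sgraph) : Prop := forall x : G, #|[set y | adj x y]| = 3.

Section EdgeColorings.
Variable G : sgraph.

Definition is_edge (e : {set G}) : bool :=
  [exists x, exists y, adj x y && (e == [set x; y])].

Definition edge : finType := {e : {set G} | is_edge e}.

Definition adjacent_edges (e : edge) : {set edge} :=
  [set f | (f != e) && (val f :&: val e != set0)].

Section Coloring.
Variables (C : choiceType) (phi : edge -> C).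

Definition adjacent_colors (e : edge) : {fset C} :=
  [fset phi f | f in adjacent_edges e]%fset.

Definition proper_coloring : Prop :=
  forall e f, f \in adjacent_edges e -> phi e <> phi f.

Definition rich (e : edge) : Prop := #|` adjacent_colors e| = 4.
Definition poor (e : edge) : Prop := #|` adjacent_colors e| = 2.

Definition normal_coloring : Prop :=
  proper_coloring /\ forall e, rich e \/ poor e.

End Coloring.

Definition normally_choosable (k : nat) : Prop :=
  forall (C : choiceType) (L : edge -> {fset C}),
    (forall e, k <= #|` L e|) ->
    exists phi : edge -> C, normal_coloring phi /\ forall e, phi e \in L e.

Definition is_list_normal_chromatic_index (k : nat) : Prop :=
  normally_choosable k /\ forall j, normally_choosable j -> k <= j.

End EdgeColorings.

(* Main.v *)
Require Import Defs.
From mathcomp Require Import all_boot.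
From mathcomp Require Import finmap zify.
From Stdlib Require Import Classical.

Set Implicit Arguments.
Unset Strict Implicit.
Unset Printing Implicit Defensive.

(** A cubic graph has a list normal chromatic index because lists as long as
    its number of edges allow all edges to get different colors, and then every
    edge is rich.  So it suffices to find infinitely many cubic graphs that are
    not normally 8-choosable, and any cubic graph containing the following
    gadget is one ([gadget_not_choosable]).

    The gadget is K_{3,3}, with sides {a0, a1, a2} and {b0, b1, b2}, whose edge
    a0b0 is subdivided by a vertex v; the third neighbor of v is a vertex w
    outside the gadget.  Every edge gets the list {0..7}, except vw, which gets
    {8..15}, and a0b1, which gets {16..23}.  An edge is poor exactly when the
    two colors seen at one end are the two colors seen at the other end.  Hence
    an edge having vw or a0b1 next to it at one end, and only edges with a
    disjoint list at the other, must be rich: this covers va0, vb0, a0b2, a1b1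
    and a2b1.  If one of the five other edges of the gadget were poor, the
    resulting equalities of colors would, directly or by making further edges
    poor, give the same color to two edges that are adjacent or joined by a rich
    edge ([gadget_colors]).  So every edge of the gadget is rich, which forces
    different colors on any two edges joined by an edge of the gadget.  Any two
    of its ten edges are adjacent or so joined.  In particular, the nine edges
    other than a0b1 have nine different colors; but these colors all come from
    {0..7}.

    A gadget has one vertex of degree 2, so linking the vertices v of two
    gadgets gives a cubic graph.  The n-th graph of the family consists of n+1
    disjoint copies of it; the number of vertices tells these graphs apart. *)

(** * Two general facts *)

Lemma eq_set2 (T : finType) (a b c d : T) :
  ([set a; b] == [set c; d]) =
  (a == c) && (b == d) || (a == d) && (b == c).
Proof.
apply/eqP/idP => [E|/orP[]/andP[/eqP-> /eqP->] //]; last exact: setUC.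
have: a \in [set c; d] by rewrite -E set21.
have: b \in [set c; d] by rewrite -E set22.
have: c \in [set a; b] by rewrite E set21.
have: d \in [set a; b] by rewrite E set22.
rewrite !inE (eq_sym c) (eq_sym c) (eq_sym d) (eq_sym d).
by do 4 case: eqP => //= ?; subst; rewrite ?eqxx.
Qed.

Lemma least_nat (P : nat -> Prop) :
  (exists n, P n) -> exists k, P k /\ forall j, P j -> k <= j.
Proof.
case=> n; elim/ltn_ind: n => n IH Pn.
have [[m [lt_mn Pm]]|min_n] := classic (exists m, m < n /\ P m).
  exact: IH Pm.
exists n; split=> // j Pj; rewrite leqNgt; apply/negP => lt_jn.
by apply: min_n; exists j.
Qed.

(** * The edges next to an edge of a cubic graph *)

Section CubicNeighborhood.
Variable G : sgraph.
Hypothesis cubicG : cubic G.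

Lemma cubic_adjE (x p q r : G) :
  adj x p -> adj x q -> adj x r -> uniq [:: p; q; r] ->
  adj x =i [:: p; q; r].
Proof.
move=> xp xq xr Upqr.
have sub : [set z in [:: p; q; r]] \subset [set z | adj x z].
  by apply/subsetP => z; rewrite !inE => /or3P[]/eqP->.
have/eqP/setP eq_s : [set z in [:: p; q; r]] == [set z | adj x z].
  by rewrite eqEcard sub cubicG cardsE (card_uniqP Upqr).
by move=> z; have := eq_s z; rewrite !inE.
Qed.

Lemma cubic_other_neighbors (x y : G) :
  adj x y -> exists p q, [/\ adj x p, adj x q & uniq [:: y; p; q]].
Proof.
move=> xy; have := cubicG x; rewrite (cardsD1 y) inE xy.
rewrite add1n => /eqP; rewrite eqSS => /cards2P[p [q [p'q /setP E]]].
have := E p; have := E q; rewrite !inE !eqxx orbT /=.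
move=> /andP[q'y xq] /andP[p'y xp]; exists p, q; split=> //=.
by rewrite !inE eq_sym negb_or p'y eq_sym q'y p'q.
Qed.

Lemma edge_ends (e : edge G) : exists x y, adj x y /\ val e = [set x; y].
Proof.
by case/existsP: (valP e) => x /existsP[y /andP[xy /eqP E]]; exists x, y.
Qed.

Lemma edge_eqE (e f : edge G) : (e == f) = (val e == val f).
Proof. by rewrite val_eqE. Qed.

Lemma is_edge_pair (x y : G) : adj x y -> is_edge [set x; y].
Proof.
by move=> xy; apply/existsP; exists x; apply/existsP; exists y; rewrite xy /=.
Qed.

Section Star.
Variables x y x1 x2 y1 y2 : G.
Hypotheses (xy : adj x y) (xx1 : adj x x1) (xx2 : adj x x2).
Hypotheses (yy1 : adj y y1) (yy2 : adj y y2).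
Hypotheses (Ux : uniq [:: y; x1; x2]) (Uy : uniq [:: x; y1; y2]).
Variables e e1 e2 e3 e4 : edge G.
Hypotheses (Ee : val e = [set x; y]).
Hypotheses (E1 : val e1 = [set x; x1]) (E2 : val e2 = [set x; x2]).
Hypotheses (E3 : val e3 = [set y; y1]) (E4 : val e4 = [set y; y2]).

(** In a cubic graph the four edges leaving the ends of xy are all the edges
    adjacent to xy; so the colors seen by xy can be listed. *)
Lemma adjacent_edgesE : adjacent_edges e =i [:: e1; e2; e3; e4].
Proof.
have x'y : (x == y) = false by apply: contraTF xy => /eqP->; rewrite adj_irrefl.
have yx : adj y x by rewrite adj_sym.
have Nx := cubic_adjE xy xx1 xx2 Ux.
have Ny := cubic_adjE yx yy1 yy2 Uy.
move: Ux Uy; rewrite /= !inE !negb_or -!andbA.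
move=> /and4P[/negPf y'x1 /negPf y'x2 /negPf x1'x2 _].
move=> /and4P[/negPf x'y1 /negPf x'y2 /negPf y1'y2 _] f.
rewrite !inE !edge_eqE E1 E2 E3 E4 Ee.
have y'x : (y == x) = false by rewrite eq_sym.
apply/idP/idP => [/andP[f'e /set0Pn[s]]|]; last first.
  case/or4P=> /eqP->; rewrite eq_set2 ?eqxx ?y'x ?x'y /=.
  - rewrite eq_sym y'x1; apply/set0Pn; exists x;
    by rewrite !inE eqxx.
  - rewrite eq_sym y'x2; apply/set0Pn; exists x;
    by rewrite !inE eqxx.
  - rewrite eq_sym x'y1; apply/set0Pn; exists y.
    by rewrite !inE eqxx orbT.
  - rewrite eq_sym x'y2; apply/set0Pn; exists y.
    by rewrite !inE eqxx orbT.
have [a [b [ab Ef]]] := edge_ends f.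
rewrite Ef in f'e *; rewrite !inE => /andP[sf se].
(* s is the end that f shares with e, and t is the other end of f. *)
have [t st Et] : exists2 t, adj s t & [set a; b] = [set s; t].
  case/orP: sf => /eqP->; first by exists b.
  by exists a; rewrite 1?adj_sym // setUC.
rewrite {}Et {a b ab Ef sf} in f'e *.
case/orP: se => /eqP Es; subst s.
- have := Nx t; rewrite -topredE /= st !inE => /esym/or3P[]/eqP Et; subst t.
  + by rewrite eqxx in f'e.
  + by rewrite eqxx.
  + by rewrite eqxx orbT.
- have := Ny t; rewrite -topredE /= st !inE => /esym/or3P[]/eqP Et; subst t.
  + by rewrite setUC eqxx in f'e.
  + by rewrite eqxx !orbT.
  + by rewrite eqxx !orbT.
Qed.

(** The four edges are distinct even when xy lies in a triangle, where the
    vertices x1, x2, y1, y2 are not. *)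
Lemma adjacent_edges_uniq : uniq [:: e1; e2; e3; e4].
Proof.
have x'y : (x == y) = false by apply: contraTF xy => /eqP->; rewrite adj_irrefl.
move: Ux Uy; rewrite /= !inE !edge_eqE E1 E2 E3 E4 !eq_set2 !eqxx x'y.
rewrite !negb_or -!andbA.
move=> /and4P[/negPf y'x1 /negPf y'x2 /negPf x1'x2 _].
move=> /and4P[/negPf x'y1 /negPf x'y2 /negPf y1'y2 _].
have x'x2 : (x == x2) = false.
  by apply: contraTF xx2 => /eqP<-; rewrite adj_irrefl.
have y'y2 : (y == y2) = false.
  by apply: contraTF yy2 => /eqP<-; rewrite adj_irrefl.
by rewrite x1'x2 x'y1 x'y2 y1'y2 x'x2 y'y2.
Qed.

Variables (C : choiceType) (phi : edge G -> C).

Lemma adjacent_colorsE :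
  adjacent_colors phi e =i [:: phi e1; phi e2; phi e3; phi e4].
Proof.
move=> c; apply/imfsetP/idP => [[f /= ef ->]|].
  rewrite adjacent_edgesE in ef.
  exact: (map_f phi (x := f) (s := [:: e1; e2; e3; e4])).
rewrite -[[:: _; _; _; _]]/(map phi [:: e1; e2; e3; e4]).
by case/mapP => f ef ->; exists f => //=; rewrite adjacent_edgesE.
Qed.

Lemma card_adjacent_colors :
  #|` adjacent_colors phi e| =
    size (undup [:: phi e1; phi e2; phi e3; phi e4]).
Proof.
apply/eqP; rewrite -uniq_size_uniq ?undup_uniq ?fset_uniq // => c.
by rewrite mem_undup -adjacent_colorsE.
Qed.

End Star.

(** What a normal coloring satisfies at an edge of color c, when p, q are the
    colors of the other edges at one end and r, s at the other: the edge is rich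
    in the first case, poor in the second. *)
Definition normal_at (C : eqType) (c p q r s : C) : Prop :=
  uniq [:: c; p; q; r; s] \/
  uniq [:: c; p; q] /\ (p = r /\ q = s \/ p = s /\ q = r).

Section PairColor.
Variables (C : choiceType) (phi : edge G -> C) (e0 : edge G).

(** Colorings are easier to handle as symmetric functions of two vertices; the
    edge e0 only serves to give a value to pairs of vertices not joined by an
    edge. *)
Definition pair_color (x y : G) : C := phi (insubd e0 [set x; y]).

Lemma pair_colorC x y : pair_color x y = pair_color y x.
Proof. by rewrite /pair_color setUC. Qed.

Lemma val_pair_edge x y : adj x y -> val (insubd e0 [set x; y]) = [set x; y].
Proof. by move=> xy; rewrite val_insubd is_edge_pair. Qed.

Lemma normal_at_edge x y x1 x2 y1 y2 :
  normal_coloring phi ->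
  adj x y -> adj x x1 -> adj x x2 -> adj y y1 -> adj y y2 ->
  uniq [:: y; x1; x2] -> uniq [:: x; y1; y2] ->
  normal_at (pair_color x y) (pair_color x x1) (pair_color x x2)
            (pair_color y y1) (pair_color y y2).
Proof.
move=> [proper_phi normal_phi] xy xx1 xx2 yy1 yy2 Ux Uy.
have Ee := val_pair_edge xy.
have [E1 E2] := (val_pair_edge xx1, val_pair_edge xx2).
have [E3 E4] := (val_pair_edge yy1, val_pair_edge yy2).
rewrite /pair_color.
move: (insubd e0 _) (insubd e0 _) (insubd e0 _) (insubd e0 _) (insubd e0 _)
  Ee E1 E2 E3 E4 => e4 e3 e2 e1 e Ee E1 E2 E3 E4.
have A := adjacent_edgesE xy xx1 xx2 yy1 yy2 Ux Uy Ee E1 E2 E3 E4.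
have := adjacent_edges_uniq xy xx2 yy2 Ux Uy E1 E2 E3 E4.
rewrite /= !inE !negb_or -!andbA => /and5P[e1'e2 _ _ _ /and3P[_ e3'e4 _]].
have pe f : f \in [:: e1; e2; e3; e4] -> phi e != phi f.
  by move=> ef; apply/eqP/proper_phi; rewrite A.
have meet z a b f g : f != g -> val f = [set z; a] -> val g = [set z; b] ->
    phi f != phi g.
  move=> f'g Ef Eg; apply/eqP/proper_phi; rewrite inE eq_sym f'g Ef Eg.
  by apply/set0Pn; exists z; rewrite !inE eqxx.
have p12 := meet _ _ _ _ _ e1'e2 E1 E2.
have p34 := meet _ _ _ _ _ e3'e4 E3 E4.
have [pe1 pe2 pe3 pe4] : [/\ phi e != phi e1, phi e != phi e2,
    phi e != phi e3 & phi e != phi e4].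
  by split; apply: pe; rewrite !inE eqxx ?orbT.
move: (normal_phi e); rewrite /rich /poor.
rewrite (card_adjacent_colors xy xx1 xx2 yy1 yy2 Ux Uy Ee E1 E2 E3 E4).
move: (phi e) (phi e1) (phi e2) (phi e3) (phi e4) p12 p34 pe1 pe2 pe3 pe4.
move=> c p q r s p'q r's c'p c'q c'r c's [sz4|sz2]; [left|right].
  have: ~~ (size (undup [:: p; q; r; s]) < size [:: p; q; r; s]) by rewrite sz4.
  rewrite ltn_size_undup negbK => Upqrs; rewrite cons_uniq Upqrs andbT.
  by rewrite !inE !negb_or c'p c'q c'r.
split; first by rewrite /= !inE negb_or c'p c'q p'q.
move: sz2; rewrite /= !inE (negPf p'q) (negPf r's) /=.
move/eqP: p'q; move/eqP: r's.
case: (p =P r) => pr; case: (p =P s) => ps; case: (q =P r) => qr;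
  by case: (q =P s) => qs //= *; (try by case: pr; congruence); auto; congruence.
Qed.
End PairColor.
End CubicNeighborhood.

(** * Normal colorings of the gadget *)

Section GadgetColors.
Variable C : eqType.
Implicit Types c p q r s : C.

(** A poor edge sees the same colors at both ends, so one color seen at one end
    only makes the edge rich. *)
Lemma normal_at_mismatch c p q r s :
  normal_at c p q r s -> p \notin [:: r; s] -> uniq [:: c; p; q; r; s].
Proof.
by case=> // -[_ [[<- _]|[<- _]]]; rewrite !inE eqxx ?orbT.
Qed.

(* Turns the distinctness of a list of colors into separate disequalities, on
   which congruence can work. *)
Ltac spread U :=
  move: U; rewrite /= !inE !negb_or -!andbA;
  repeat (case/andP => /eqP ?); move=> _.

(** Here f, va, vb, xij are the colors of vw, va0, vb0 and aibj.  The first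
    five hypotheses hold thanks to the lists of vw and a0b1. *)
Lemma gadget_colors (f va vb x01 x02 x10 x11 x12 x20 x21 x22 : C) :
    f \notin [:: x01; x02] -> f \notin [:: x10; x20] ->
    x01 \notin [:: x10; x12] -> x01 \notin [:: x20; x22] ->
    x01 \notin [:: x12; x22] ->
    normal_at va f vb x01 x02 -> normal_at vb f va x10 x20 ->
    normal_at x01 va x02 x11 x21 -> normal_at x02 x01 va x12 x22 ->
    normal_at x10 vb x20 x11 x12 -> normal_at x20 vb x10 x21 x22 ->
    normal_at x11 x01 x21 x10 x12 -> normal_at x12 x02 x22 x10 x11 ->
    normal_at x21 x01 x11 x20 x22 -> normal_at x22 x02 x12 x20 x21 ->
  uniq [:: va; vb; x02; x10; x20; x11; x12; x21; x22].
Proof.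
move=> Ma Mb M11 M21 M02 Na Nb N01 N02 N10 N20 N11 N12 N21 N22.
(* The five edges that are rich because of the colors f and x01. *)
have Ua := normal_at_mismatch Na Ma.
have Ub := normal_at_mismatch Nb Mb.
have U02 := normal_at_mismatch N02 M02.
have U11 := normal_at_mismatch N11 M11.
have U21 := normal_at_mismatch N21 M21.
spread Ua; spread Ub; spread U02; spread U11; spread U21.
have U01 : uniq [:: x01; va; x02; x11; x21].
  case: N01 => // -[_ poor01]; exfalso.
  (* If a0b1 is poor, then up to exchanging a1 and a2 we have va = x11 and
     x02 = x21.  As a2b2 joins edges of the same color x02 = x21, it is poor,
     so x20 = x12; then a1b0 is poor as well, so vb = x11 = va. *)
  case: poor01 => -[? ?].
    case: N22 => [U22|[U22]]; spread U22; first by congruence.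
    case=> -[? ?]; first by congruence.
    case: N10 => [U10|[U10]]; spread U10; first by congruence.
    by case=> -[? ?]; congruence.
  case: N12 => [U12|[U12]]; spread U12; first by congruence.
  case=> -[? ?]; first by congruence.
  case: N20 => [U20|[U20]]; spread U20; first by congruence.
  by case=> -[? ?]; congruence.
spread U01.
have U10 : uniq [:: x10; vb; x20; x11; x12].
  case: N10 => // -[_ poor10]; exfalso.
  (* The rich edge a2b1 joins the edges of colors x20 and x11, so if a1b0 is
     poor, then x20 = x12.  As a2b2 joins edges of this color, it is poor too,
     so x21 = x02, although the rich edge a0b1 joins these two edges. *)
  case: poor10 => -[? ?]; last by congruence.
  case: N22 => [U22|[U22]]; spread U22; first by congruence.
  by case=> -[? ?]; congruence.
have U20 : uniq [:: x20; vb; x10; x21; x22].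
  case: N20 => // -[_ poor20]; exfalso.
  case: poor20 => -[? ?]; last by congruence.
  case: N12 => [U12|[U12]]; spread U12; first by congruence.
  by case=> -[? ?]; congruence.
spread U10; spread U20.
(* Each equality of colors that makes a1b2 or a2b2 poor concerns two edges that
   are joined by an edge now known to be rich. *)
have U12 : uniq [:: x12; x02; x22; x10; x11].
  by case: N12 => // -[_ [[? ?]|[? ?]]]; exfalso; congruence.
have U22 : uniq [:: x22; x02; x12; x20; x21].
  by case: N22 => // -[_ [[? ?]|[? ?]]]; exfalso; congruence.
spread U12; spread U22.
by repeat (apply/andP; split; first by apply/eqP; congruence).
Qed.
End GadgetColors.

(** * Graphs containing the gadget are not 8-choosable *)

Section Gadget.
Variable G : sgraph.
Hypothesis cubicG : cubic G.
Variables v w a0 a1 a2 b0 b1 b2 : G.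
Hypothesis uniq_gadget : uniq [:: v; w; a0; a1; a2; b0; b1; b2].
Hypothesis adj_gadget : all (fun e => adj e.1 e.2)
  [:: (v, w); (v, a0); (v, b0); (a0, b1); (a0, b2);
      (a1, b0); (a1, b1); (a1, b2); (a2, b0); (a2, b1); (a2, b2)].

Definition palette (k : nat) : {fset nat} := [fset c in iota (8 * k) 8]%fset.

Definition gadget_lists (e : edge G) : {fset nat} :=
  if val e == [set v; w] then palette 1
  else if val e == [set a0; b1] then palette 2 else palette 0.

Lemma mem_palette k c : (c \in palette k) = (8 * k <= c < 8 * k + 8).
Proof. by rewrite in_fset; exact: mem_iota. Qed.

Lemma palette_neq i c j d :
  c \in palette i -> d \in palette j -> i != j -> c != d.
Proof. by rewrite !mem_palette; lia. Qed.

Lemma card_palette k : #|` palette k| = 8.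
Proof. by rewrite card_fseq undup_id ?iota_uniq ?size_iota. Qed.

Lemma neqC (T : eqType) (x y : T) : (x == y) = false -> (y == x) = false.
Proof. by rewrite eq_sym. Qed.

(* Evaluates equalities between vertices of the gadget, and between pairs of
   them, from the disequalities in the context. *)
Ltac vneq := rewrite /= ?inE ?eq_set2;
  repeat (rewrite ?eqxx /=; match goal with
   | H : (?x == ?y) = false |- context [?x == ?y] => rewrite H
   | H : (?x == ?y) = false |- context [?y == ?x] => rewrite (neqC H)
  end).

(** Transports the coloring to the eleven colors of [gadget_colors]; nine of
    them would be distinct members of {0..7}. *)
Lemma gadget_not_choosable : ~ normally_choosable G 8.
Proof.
case/(_ nat gadget_lists) => [e|phi [normal_phi phiL]].
  rewrite /gadget_lists.
  by case: ifP => _; [|case: ifP => _]; rewrite card_palette.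
move: adj_gadget => /=.
move=> /and5P[vw va vb a01 /and5P[a02 a10 a11 a12 /and4P[a20 a21 a22 _]]].
pose e0 : edge G := Sub [set v; w] (is_edge_pair vw).
pose c := pair_color phi e0.
have cC x y : c x y = c y x by exact: pair_colorC.
have cL x y : adj x y -> c x y \in
    if [set x; y] == [set v; w] then palette 1
    else if [set x; y] == [set a0; b1] then palette 2 else palette 0.
  move=> xy; have := phiL (insubd e0 [set x; y]).
  by rewrite /gadget_lists val_pair_edge.
move: uniq_gadget; rewrite /= !inE !negb_or -!andbA.
repeat (case/andP => /negPf ?); move=> _.
have Lf := cL _ _ vw; have Lva := cL _ _ va; have Lvb := cL _ _ vb.
have L01 := cL _ _ a01; have L02 := cL _ _ a02.
have L10 := cL _ _ a10; have L11 := cL _ _ a11; have L12 := cL _ _ a12.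
have L20 := cL _ _ a20; have L21 := cL _ _ a21; have L22 := cL _ _ a22.
revert Lf Lva Lvb L01 L02 L10 L11 L12 L20 L21 L22.
vneq => Lf Lva Lvb L01 L02 L10 L11 L12 L20 L21 L22.
have flip (x y : G) : adj x y -> adj y x by rewrite adj_sym.
have Na : normal_at (c v a0) (c v w) (c v b0) (c a0 b1) (c a0 b2).
  by apply: normal_at_edge => //; try apply: flip => //; vneq.
have Nb : normal_at (c v b0) (c v w) (c v a0) (c a1 b0) (c a2 b0).
  rewrite (cC a1) (cC a2).
  by apply: normal_at_edge => //; try apply: flip => //; vneq.
have N01 : normal_at (c a0 b1) (c v a0) (c a0 b2) (c a1 b1) (c a2 b1).
  rewrite (cC v) (cC a1) (cC a2).
  by apply: normal_at_edge => //; try apply: flip => //; vneq.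
have N02 : normal_at (c a0 b2) (c a0 b1) (c v a0) (c a1 b2) (c a2 b2).
  rewrite (cC v) (cC a1) (cC a2).
  by apply: normal_at_edge => //; try apply: flip => //; vneq.
have N10 : normal_at (c a1 b0) (c v b0) (c a2 b0) (c a1 b1) (c a1 b2).
  rewrite (cC v) (cC a2) (cC a1 b0).
  by apply: normal_at_edge => //; try apply: flip => //; vneq.
have N20 : normal_at (c a2 b0) (c v b0) (c a1 b0) (c a2 b1) (c a2 b2).
  rewrite (cC v) (cC a1) (cC a2 b0).
  by apply: normal_at_edge => //; try apply: flip => //; vneq.
have N11 : normal_at (c a1 b1) (c a0 b1) (c a2 b1) (c a1 b0) (c a1 b2).
  rewrite (cC a0) (cC a2) (cC a1 b1).
  by apply: normal_at_edge => //; try apply: flip => //; vneq.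
have N12 : normal_at (c a1 b2) (c a0 b2) (c a2 b2) (c a1 b0) (c a1 b1).
  rewrite (cC a0) (cC a2) (cC a1 b2).
  by apply: normal_at_edge => //; try apply: flip => //; vneq.
have N21 : normal_at (c a2 b1) (c a0 b1) (c a1 b1) (c a2 b0) (c a2 b2).
  rewrite (cC a0) (cC a1) (cC a2 b1).
  by apply: normal_at_edge => //; try apply: flip => //; vneq.
have N22 : normal_at (c a2 b2) (c a0 b2) (c a1 b2) (c a2 b0) (c a2 b1).
  rewrite (cC a0) (cC a1) (cC a2 b2).
  by apply: normal_at_edge => //; try apply: flip => //; vneq.
have U : uniq [:: c v a0; c v b0; c a0 b2; c a1 b0; c a2 b0;
                  c a1 b1; c a1 b2; c a2 b1; c a2 b2].
  apply: gadget_colors Na Nb N01 N02 N10 N20 N11 N12 N21 N22.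
  - by rewrite !inE negb_or !(palette_neq Lf L01, palette_neq Lf L02).
  - by rewrite !inE negb_or !(palette_neq Lf L10, palette_neq Lf L20).
  - by rewrite !inE negb_or !(palette_neq L01 L10, palette_neq L01 L12).
  - by rewrite !inE negb_or !(palette_neq L01 L20, palette_neq L01 L22).
  - by rewrite !inE negb_or !(palette_neq L01 L12, palette_neq L01 L22).
suff /(uniq_leq_size U) : {subset [:: c v a0; c v b0; c a0 b2; c a1 b0; c a2 b0;
                  c a1 b1; c a1 b2; c a2 b1; c a2 b2] <= iota 0 8} by [].
have P0 d : d \in palette 0 -> d \in iota 0 8.
  by rewrite mem_palette mem_iota.
move=> d dU; apply: P0; move: d dU; apply/allP.
by rewrite /= Lva Lvb L02 L10 L20 L11 L12 L21 L22.
Qed.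
End Gadget.

(** * Existence of the list normal chromatic index *)

(** Greedy choice: at each step fewer colors have been used than the next list
    contains. *)
Lemma injective_choice (E : finType) (C : choiceType) (L : E -> {fset C}) :
  (forall e, #|E| <= #|` L e|) ->
  exists phi : E -> C, injective phi /\ forall e, phi e \in L e.
Proof.
move=> largeL.
have [phi0 phi0L] : exists phi : E -> C, forall e, phi e \in L e.
  have neL e : exists c, c \in L e.
    apply/fset0Pn; rewrite -cardfs_gt0; apply: leq_trans (largeL e).
    by apply/card_gt0P; exists e.
  by exists (fun e => xchoose (neL e)) => e; apply: xchooseP.
suff [phi [inj_phi phiL]] : exists phi : E -> C,
    {in enum E &, injective phi} /\ forall e, phi e \in L e.
  by exists phi; split=> // x y; apply: inj_phi; rewrite mem_enum.
elim: (enum E) (enum_uniq E) => [|e s IHs] /=; first by exists phi0.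
case/andP=> s'e Us; have [phi [inj_phi phiL]] := IHs Us.
have [c Lc s'c] : exists2 c, c \in L e & c \notin map phi s.
  apply/hasP; rewrite -[has _ _]negbK -all_predC; apply/negP => /allP sub.
  have : #|` L e| <= size (map phi s).
    by apply: uniq_leq_size => [|c /sub /=]; rewrite ?fset_uniq ?negbK.
  rewrite size_map leqNgt => /negP; apply; apply: leq_trans (largeL e).
  rewrite -[(size s).+1]/(size (e :: s)) -(card_uniqP _) /= ?s'e //.
  exact: max_card.
exists (fun x => if x == e then c else phi x); split=> [x y|x]; last first.
  by case: eqP => [->|].
rewrite !inE; case: (x =P e) => [-> _|_ /= sx]; case: (y =P e) => [-> //|_ /= sy].
- by move=> Ec; case/negP: s'c; rewrite Ec map_f.
- by move=> _ Ec; case/negP: s'c; rewrite -Ec map_f.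
- exact: inj_phi.
Qed.

Lemma injective_normal (G : sgraph) (C : choiceType) (phi : edge G -> C) :
  cubic G -> injective phi -> normal_coloring phi.
Proof.
move=> cubicG inj_phi; split=> [e f|e].
  by rewrite inE => /andP[/eqP f'e _] /inj_phi /esym.
left; have [x [y [xy Ee]]] := edge_ends e.
have [x1 [x2 [xx1 xx2 Ux]]] := cubic_other_neighbors cubicG xy.
have yx : adj y x by rewrite adj_sym.
have [y1 [y2 [yy1 yy2 Uy]]] := cubic_other_neighbors cubicG yx.
have [E1 E2] := (val_pair_edge e xx1, val_pair_edge e xx2).
have [E3 E4] := (val_pair_edge e yy1, val_pair_edge e yy2).
rewrite /rich (card_adjacent_colors cubicG xy xx1 xx2 yy1 yy2 Ux Uy Ee E1 E2 E3 E4).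
set s := (X in undup X).
have -> : s = map phi [:: insubd e [set x; x1]; insubd e [set x; x2];
                          insubd e [set y; y1]; insubd e [set y; y2]] by [].
rewrite undup_id ?size_map // map_inj_uniq //.
exact: (adjacent_edges_uniq xy xx2 yy2 Ux Uy E1 E2 E3 E4).
Qed.

Lemma normally_choosable_leq (G : sgraph) j k :
  j <= k -> normally_choosable G j -> normally_choosable G k.
Proof. by move=> le_jk ch C L /(_ _)/(leq_trans le_jk)-/ch. Qed.

Lemma cubic_index_exists (G : sgraph) :
  cubic G -> exists k, is_list_normal_chromatic_index G k.
Proof.
move=> cubicG; apply: least_nat; exists #|edge G| => C L largeL.
have [phi [inj_phi phiL]] := injective_choice largeL.
by exists phi; split=> //; apply: injective_normal.
Qed.

(** * The family *)

(** [None] is v; [Some (s, i)] is a_i or b_i, depending on the side s. *)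
Definition gadget_vertex : finType := option (bool * 'I_3).

Definition gadget_adj (x y : gadget_vertex) : bool :=
  match x, y with
  | None, None => false
  | None, Some (_, i) | Some (_, i), None => i == ord0
  | Some (s, i), Some (t, j) => (s != t) && ((i != ord0) || (j != ord0))
  end.

(** The first component numbers the copies; in a copy, the boolean chooses one
    of two gadgets, which are linked by the edge between their vertices v. *)
Definition family_vertex (n : nat) : finType :=
  ('I_n.+1 * (bool * gadget_vertex))%type.

Definition family_adj n (x y : family_vertex n) : bool :=
  let: (k, (d, a)) := x in
  let: (l, (e, b)) := y in
  (k == l) &&
  (if d == e then gadget_adj a b else (a == None) && (b == None)).

Lemma family_adj_sym n : symmetric (@family_adj n).
Proof.
move=> [k [d a]] [l [e b]] /=; rewrite eq_sym (eq_sym d) andbC [RHS]andbC.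
congr (_ && _); case: eqP => _; last exact: andbC.
by case: a b => [[s i]|] [[t j]|] //=; rewrite eq_sym orbC.
Qed.

Lemma family_adj_irrefl n : irreflexive (@family_adj n).
Proof. by move=> [k [d [[s i]|]]] /=; rewrite !eqxx. Qed.

Definition family n : sgraph :=
  SGraph (@family_adj_sym n) (@family_adj_irrefl n).

Lemma family_cubic n : cubic (family n).
Proof.
move=> [k [d a]].
pose o1 : 'I_3 := Ordinal (isT : 1 < 3); pose o2 : 'I_3 := Ordinal (isT : 2 < 3).
pose same b : family n := (k, (d, b)).
pose row s := [:: same (Some (s, ord0)); same (Some (s, o1)); same (Some (s, o2))].
pose nbrs := match a with
  | None => [:: (k, (~~ d, None)); same (Some (false, ord0)); same (Some (true, ord0))]
  | Some (s, i) =>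
    if i == ord0 then same None :: behead (row (~~ s)) else row (~~ s)
  end.
have -> : [set y : family n | adj ((k, (d, a)) : family n) y] = [set y in nbrs].
  apply/setP => -[l [e b]]; rewrite !inE /= /nbrs /row /same {nbrs row same}.
  case: a => [[s [[|[|[|//]]] lt_i]]|] /=; rewrite !inE !xpair_eqE (eq_sym l);
  case: (k == l) => //=; case: b => [[t [[|[|[|//]]] lt_j]]|];
  by case: d e => [] []; try case: s; try case: t.
rewrite cardsE.
have /card_uniqP-> : uniq nbrs.
  rewrite /nbrs /row /same {nbrs row same}.
  case: a => [[s [[|[|[|//]]] lt_i]]|] /=; rewrite !inE !xpair_eqE eqxx;
  by case: d; try case: s.
by rewrite /nbrs; case: a {nbrs} => [[s i]|] //; case: ifP.
Qed.


Lemma family_not_iso i j : i <> j -> ~ graph_iso (family i) (family j).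
Proof.
move=> neq_ij [f bij_f _]; apply: neq_ij.
have half_gt0 : 0 < #|{: bool * gadget_vertex}|.
  by apply/card_gt0P; exists (true, None).
have card_family n : #|family n| = n.+1 * #|{: bool * gadget_vertex}|.
  by rewrite card_prod card_ord.
have /eqP := bij_eq_card bij_f.
by rewrite !card_family eqn_pmul2r // eqSS => /eqP.
Qed.

Theorem theorem5p1 :
  exists G : nat -> sgraph,
    (forall i j : nat, i <> j -> ~ graph_iso (G i) (G j)) /\
    (forall i : nat, cubic (G i) /\
       exists k : nat, is_list_normal_chromatic_index (G i) k /\ 9 <= k).
Proof.
exists family; split=> [|n]; first exact: family_not_iso.
have cubicG := @family_cubic n; split=> //.
have [k [ch_k min_k]] := cubic_index_exists cubicG.
exists k; split=> //; rewrite leqNgt; apply/negP => k_le8.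
pose x d a : family n := (ord0, (d, a)).
pose u s (i : 'I_3) : family n := x false (Some (s, i)).
pose o1 : 'I_3 := Ordinal (isT : 1 < 3); pose o2 : 'I_3 := Ordinal (isT : 2 < 3).
(* One gadget of the first copy, with w the vertex v of its twin. *)
apply: (@gadget_not_choosable _ cubicG (x false None) (x true None)
  (u false ord0) (u false o1) (u false o2) (u true ord0) (u true o1)
  (u true o2)) => //.
exact: normally_choosable_leq ch_k.
Qed.
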